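(* Let $t>2$ be an even natural number, $n=2t+1$, and let $i$ be a natural number with $\gcd(i,n)=1$. Then the inverse $(2^t+2^{t/2}-1)^{-1}\pmod{2^n-1}$ of the even Niho exponent is never cyclotomic equivalent to $e((t+2)/2,i)$ over $\mathbb{F}_{2^n}$.
   Context: For natural numbers $l,k$, $e(l,k)=\sum_{j=0}^{l-1}2^{jk}$. Two exponents $d,e$ are cyclotomic equivalent over $\mathbb{F}_{2^n}$ if there is a natural number $a$ with $2^a d\equiv e\pmod{2^n-1}$, or (when $\gcd(d,2^n-1)=1$) $2^a d^{-1}\equiv e\pmod{2^n-1}$, where $d^{-1}$ is the inverse of $d$ modulo $2^n-1$. *)

(* Defs.v *)
From mathcomp Require Import all_boot zify.

Set Implicit Arguments.
Unset Strict Implicit.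
Unset Printing Implicit Defensive.

Definition esum (l k : nat) : nat := \sum_(j < l) 2 ^ (j * k).

(* Meaningful only for [d] coprime to [m]; see [modinvP]. *)
Definition modinv (m d : nat) : nat := (egcdn d m).1 %% m.

Definition cyclotomic_equiv (n d e : nat) : Prop :=
  (exists a : nat, 2 ^ a * d = e %[mod 2 ^ n - 1]) \/
  (coprime d (2 ^ n - 1) /\
   exists a : nat, 2 ^ a * modinv (2 ^ n - 1) d = e %[mod 2 ^ n - 1]).

(* For [t] even, with [n = 2 t + 1]. *)
Definition even_niho (t : nat) : nat := 2 ^ t + 2 ^ t./2 - 1.

Lemma modinvP (m d : nat) :
  coprime d m -> d * modinv m d = 1 %[mod m].
Proof.
rewrite /coprime /modinv => /eqP co_dm.
have [d0|d_gt0] := posnP d.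
  by move: co_dm; rewrite d0 gcd0n => ->; rewrite !modn1.
case: egcdnP => //= u v; rewrite co_dm => uv _.
by rewrite modnMmr mulnC uv modnMDl.
Qed.

Lemma coprime_even_niho (t : nat) :
  ~~ odd t -> coprime (even_niho t) (2 ^ (2 * t + 1) - 1).
Proof.
move=> t_even; rewrite /even_niho.
have -> : 2 ^ t = (2 ^ t./2) ^ 2 by rewrite -expnM muln2 even_halfK.
have -> : 2 ^ (2 * t + 1) = 2 * (2 ^ t./2) ^ 4.
  by rewrite addn1 expnS -expnM; congr (_ * 2 ^ _); lia.
have co3 : coprime 3 (2 * (2 ^ t./2) ^ 4 - 1).
  rewrite prime_coprime //; apply/negP => d3.
  have : 2 * (2 ^ t./2) ^ 4 = 1 %[mod 3].
    by apply/eqP; rewrite eqn_mod_dvd // muln_gt0 !expn_gt0.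
  by rewrite -expnM (mulnC t./2) expnM -modnMmr -modnXm exp1n.
move: (2 ^ t./2) (expn_gt0 2 t./2) co3 => [//|y] _.
set M := 2 * _ - 1; set N := _ - 1 => co3.
have eN : N = y * y + 3 * y + 1 by rewrite /N !expnS expn0; lia.
have eM : M + 3 * (2 * y + 1) = 2 * N * (y * y + y + 2).
  by rewrite /M eN !expnS expn0; lia.
have gN := dvdn_gcdl N M; have gM := dvdn_gcdr N M.
have co_g3 : coprime (gcdn N M) 3.
  by apply: (coprime_dvdl gM); rewrite coprime_sym.
have g1 : gcdn N M %| 2 * y + 1.
  by rewrite -(Gauss_dvdr _ co_g3) -(dvdn_addr _ gM) eM dvdn_mulr ?dvdn_mull.
have : gcdn N M %| 4 * N + 1.
  have -> : 4 * N + 1 = (2 * y + 1) * (2 * y + 5) by rewrite eN; lia.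
  by rewrite dvdn_mulr.
by rewrite dvdn_addr ?dvdn_mull // dvdn1.
Qed.

(* Main.v *)
Require Import Defs.
From mathcomp Require Import all_boot zify.

Set Implicit Arguments.
Unset Strict Implicit.
Unset Printing Implicit Defensive.

(** Write [t = 2 s] and [n = 4 s + 1], let [N] be the Niho exponent and
    [e = e(s+1, i)].  Both kinds of equivalence, [2^a = e N] and [e = 2^a N]
    modulo [2^n - 1], become after multiplication by [2^i - 1] an instance of

      [2^(k+2s) + 2^(k+s) + 1 + 2^a = 2^k + 2^(2s) + 2^s + 2^b],

    with [k = (s+1) i] or [k = i], hence [k <> 0] modulo [n].  A residue modulo
    [2^n - 1] is a sum of fewer than [n] distinct powers [2^x], [x < n], in at
    most one way.  When the six known exponents are distinct, inserting [a] on
    the left with carries leaves at most one exponent that is not among the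
    three known ones, and likewise for [b] on the right; so equality forces each
    of [{k+2s, k+s, 0}] and [{k, 2s, s}] to contain two cyclically consecutive
    exponents, which cannot happen for both.  The remaining values
    [k = s, 2s, -s, -2s] are settled by computing the carries. *)

(** * Uniqueness of binary expansions modulo [2^n - 1] *)

Definition psum (l : seq nat) : nat := \sum_(x <- l) 2 ^ x.

Lemma psum_cons x l : psum (x :: l) = 2 ^ x + psum l.
Proof. exact: big_cons. Qed.

Lemma psum_nil : psum [::] = 0.
Proof. exact: big_nil. Qed.

Lemma psum_ord n l : uniq l -> all (gtn n) l ->
  psum l = \sum_(x < n) (val x \in l) * 2 ^ x.
Proof.
move=> ul /allP al.
have -> : psum l = \sum_(x <- iota 0 n | x \in l) 2 ^ x.
  rewrite -big_filter; apply: perm_big; apply: uniq_perm => //.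
    by rewrite filter_uniq ?iota_uniq.
  move=> x; rewrite mem_filter mem_iota /= add0n.
  by case xl: (x \in l) => //=; have /= -> := al x xl.
rewrite -[X in iota 0 X]subn0 -/(index_iota 0 n) big_mkord big_mkcond /=.
by apply: eq_bigr => x _; case: (_ \in _); rewrite ?mul1n ?mul0n.
Qed.

(** Parity determines the digit at 0; halving what remains shifts the digit functions by one. *)
Lemma binary_digits_inj n (f g : nat -> bool) :
  \sum_(x < n) f x * 2 ^ x = \sum_(x < n) g x * 2 ^ x ->
  forall x, x < n -> f x = g x.
Proof.
elim: n f g => [|n IHn] f g //; rewrite !big_ord_recl !muln1 /=.
have dbl h : \sum_(i < n) (h : nat -> bool) (bump 0 i) * 2 ^ bump 0 i =
    2 * \sum_(i < n) (h \o succn) i * 2 ^ i.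
  by rewrite big_distrr /=; apply: eq_bigr => x _; rewrite expnS mulnCA.
rewrite !dbl => E [|x]; first by move: E; case: (f 0); case: (g 0) => //; lia.
by move=> lt_x; apply: (IHn (f \o succn) (g \o succn)) => //; lia.
Qed.

Lemma psum_lt n l : uniq l -> all (gtn n) l -> size l < n -> psum l < 2 ^ n - 1.
Proof.
move=> ul al sl; rewrite (psum_ord ul al).
have geo m : \sum_(x < m) 2 ^ x = 2 ^ m - 1.
  elim: m => [|m IHm]; rewrite ?big_ord0 // big_ord_recr expnS /= IHm.
  by have := expn_gt0 2 m; lia.
(* By pigeonhole some exponent is missing, so the sum falls short of [2^n - 1], the sum of all the
   powers. *)
have [x xn xl] : exists2 x : 'I_n, true & val x \notin l.
  have : ~~ all [in l] (iota 0 n).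
    apply/allP => sub; have := uniq_leq_size (iota_uniq 0 n) sub.
    by rewrite size_iota; lia.
  case/allPn => x; rewrite mem_iota add0n => /= xn xl.
  by exists (Ordinal xn).
rewrite -geo (bigD1 x) //= [X in _ < X](bigD1 x) //= (negPf xl) mul0n add0n.
rewrite -[X in X < _]add0n -addSn leq_add ?expn_gt0 //.
by apply: leq_sum => y _; case: (_ \in _); rewrite ?mul1n.
Qed.

(** Both sums are below the modulus, hence equal as integers. The size bounds exclude the full list,
    whose sum [2^n - 1] is congruent to that of the empty list. *)
Lemma psum_mod_inj n l r :
  uniq l -> all (gtn n) l -> size l < n ->
  uniq r -> all (gtn n) r -> size r < n ->
  psum l = psum r %[mod 2 ^ n - 1] -> perm_eq l r.
Proof.
move=> ul al sl ur ar sr; rewrite !modn_small ?psum_lt // => E.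
apply: uniq_perm => // x.
case: (ltnP x n) => xn.
  move: E; rewrite (psum_ord ul al) (psum_ord ur ar) => E.
  exact: (@binary_digits_inj n (mem l) (mem r) E x xn).
have out (q : seq nat) : all (gtn n) q -> (x \in q) = false.
  by move=> /allP aq; apply/negP => /aq /=; lia.
by rewrite !out.
Qed.

(** * Adding a power of two with cyclic carries *)

Lemma pow2_mod_period n x : 2 ^ (x %% n) = 2 ^ x %[mod 2 ^ n - 1].
Proof.
have pow_n : 2 ^ n = 1 %[mod 2 ^ n - 1].
  by rewrite -{1}(subnK (expn_gt0 2 n)) modnDl.
have pow_qn : (2 ^ n) ^ (x %/ n) = 1 %[mod 2 ^ n - 1].
  by rewrite -modnXm pow_n modnXm exp1n.
rewrite [in RHS](divn_eq x n) expnD (mulnC (x %/ n)) expnM.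
by rewrite -modnMml pow_qn modnMml mul1n.
Qed.

Definition cyc_succ n x := if x + 1 == n then 0 else x + 1.

Lemma cyc_succ_lt n x : x < n -> cyc_succ n x < n.
Proof. by rewrite /cyc_succ; case: eqP; lia. Qed.

Lemma pow2_cyc_succ n x : 2 ^ cyc_succ n x = 2 ^ x + 2 ^ x %[mod 2 ^ n - 1].
Proof.
rewrite addnn -mul2n -expnS /cyc_succ addn1; case: eqP => // ->.
by rewrite -(pow2_mod_period n n) modnn.
Qed.

(* [f] is fuel; [size l] is enough, since each carry removes an element of [l]. *)
Fixpoint carry_insert n f x (l : seq nat) : seq nat :=
  if f is f'.+1 then
    if x \in l then carry_insert n f' (cyc_succ n x) (rem x l) else x :: l
  else x :: l.

Lemma carry_insertP n x l : x < n -> uniq l -> all (gtn n) l ->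
  let q := carry_insert n (size l) x l in
  [/\ uniq q, all (gtn n) q, size q <= (size l).+1 &
      psum q = psum (x :: l) %[mod 2 ^ n - 1]].
Proof.
move=> + + + /=; move: {-2}(size l) (erefl (size l)) => f.
elim: f x l => [|f IHf] x l sl xn ul al /=.
  by rewrite (size0nil (esym sl)) /= xn; split.
case: ifP => xl; last by rewrite /= xl ul xn al sl; split.
have pl := perm_to_rem xl.
have ul' := rem_uniq x ul.
have al' : all (gtn n) (rem x l) by apply/allP => y /mem_rem /(allP al).
have sl' : f = size (rem x l) by rewrite size_rem // -sl.
have [uq aq sq eq] := IHf _ _ sl' (cyc_succ_lt xn) ul' al'.
split=> //; first exact: leq_trans sq _.
rewrite eq !psum_cons /psum (perm_big _ pl) big_cons addnA.
by rewrite -modnDml pow2_cyc_succ modnDml.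
Qed.

Definition carry n x l := carry_insert n (size l) x l.

Lemma carry_notin n x l : x \notin l -> carry n x l = x :: l.
Proof. by rewrite /carry; case: (size l) => //= f /negPf ->. Qed.

Lemma carry_in n x l :
  x \in l -> carry n x l = carry n (cyc_succ n x) (rem x l).
Proof.
move=> xl; rewrite /carry size_rem //.
have : 0 < size l by case: (l) xl.
by case: (size l) => //= f _; rewrite xl.
Qed.

Lemma carry_shape n x l :
  exists c q, carry n x l = c :: q /\ {subset q <= l}.
Proof.
rewrite /carry; move: (size l) => f.
elim: f x l => [|f IHf] x l /=; first by exists x, l; split.
case: ifP => _; last by exists x, l; split.
have [c [q [-> sub]]] := IHf (cyc_succ n x) (rem x l).
by exists c, q; split=> // y /sub /mem_rem.
Qed.

(** * Carries without adjacent exponents, and the generic relation *)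

Definition has_adjacent n (l : seq nat) := has (fun x => cyc_succ n x \in l) l.

(** A carry out of [x] lands on a free place, so the process stops after one step and loses at most
    one exponent of [l]. *)
Lemma carry_nonadjacent n x l : ~~ has_adjacent n l ->
  exists c q, [/\ carry n x l = c :: q, {subset q <= l} & size l <= (size q).+1].
Proof.
move=> nadj; case: (boolP (x \in l)) => xl; last first.
  by exists x, l; rewrite carry_notin //; split.
exists (cyc_succ n x), (rem x l); split; last 1 first.
- by rewrite size_rem //; case: (size l).
- rewrite carry_in // carry_notin //; apply: contra nadj => /mem_rem sxl.
  by apply/hasP; exists x.
- by move=> y /mem_rem.
Qed.

(** The size bound leaves room for one insertion: the result still has fewer than [n] exponents, as
    [psum_mod_inj] requires. *)
Definition reduced n (l : seq nat) :=
  [&& uniq l, all (gtn n) l & (size l).+1 < n].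

Lemma carry_unique n a b l r :
  a < n -> reduced n l -> b < n -> reduced n r ->
  psum (a :: l) = psum (b :: r) %[mod 2 ^ n - 1] ->
  perm_eq (carry n a l) (carry n b r).
Proof.
move=> an /and3P[ul al ln] bn /and3P[ur ar rn] E.
have [ul' al' sl el] := carry_insertP an ul al.
have [ur' ar' sr er] := carry_insertP bn ur ar.
apply: (psum_mod_inj ul' al' _ ur' ar'); first exact: leq_ltn_trans ln.
  exact: leq_ltn_trans rn.
by rewrite el er.
Qed.

(** Without adjacency at least two exponents of [l] survive the insertion of [a]. None of them lies
    in [r], so all must equal the single new exponent on the right. *)
Lemma disjoint_adjacent n a b l r :
  a < n -> reduced n l -> b < n -> reduced n r ->
  ~~ has [in r] l -> 2 < size l ->
  psum (a :: l) = psum (b :: r) %[mod 2 ^ n - 1] -> has_adjacent n l.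
Proof.
move=> an rl bn rr dis sl E; apply: contraT => nadj.
have pq := carry_unique an rl bn rr E.
case/and3P: rl => ul al _.
have [uc _ _ _] := carry_insertP an ul al.
have [c [q [eq sub sq]]] := carry_nonadjacent a nadj.
have [c' [q' [eq' sub']]] := carry_shape n b r.
rewrite -/(carry n a l) eq /= in uc; case/andP: uc => _ uq.
have: {subset q <= [:: c']}.
  move=> y yq; rewrite inE; have := perm_mem pq y.
  rewrite eq eq' !inE yq orbT => /esym /orP[//|/sub' yr].
  by case/hasP: dis; exists y => //; apply: sub.
move/(uniq_leq_size uq) => q1; have q2 : (size q).+1 <= 2 by [].
by have := leq_trans sl (leq_trans sq q2).
Qed.

Ltac split_lia :=
  rewrite /= ?inE ?orbF ?negb_or ?andbT;
  repeat (apply/andP; split); lia.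

(* [l0] and [l1] are the residues of [k + 2 s] and [k + s] modulo [n]. *)
Lemma no_relation_generic s k l0 l1 a b (n := 4 * s + 1) :
  1 < s ->
  [|| [&& 0 < k, k < s, l0 == k + 2 * s & l1 == k + s],
      [&& s < k, k < 2 * s, l0 == k + 2 * s & l1 == k + s],
      [&& 2 * s + 1 < k, k < 3 * s + 1, l0 + n == k + 2 * s & l1 == k + s] |
      [&& 3 * s + 1 < k, k < n, l0 + n == k + 2 * s & l1 + n == k + s]] ->
  a < n -> b < n ->
  psum [:: a; l0; l1; 0] = psum [:: b; k; 2 * s; s] %[mod 2 ^ n - 1] -> False.
Proof.
rewrite /n => s1 cases an bn E.
have [rl rr dl dr] : [/\ reduced (4 * s + 1) [:: l0; l1; 0],
  reduced (4 * s + 1) [:: k; 2 * s; s],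
  ~~ has [in [:: k; 2 * s; s]] [:: l0; l1; 0] &
  ~~ has [in [:: l0; l1; 0]] [:: k; 2 * s; s]].
  clear E an bn; rewrite /reduced.
  by case/or4P: cases => /and4P[? ? /eqP ? /eqP ?]; split; split_lia.
have /hasP[x] := disjoint_adjacent an rl bn rr dl isT E.
have /hasP[y] := disjoint_adjacent bn rr an rl dr isT (esym E).
clear E an bn rl rr dl dr; rewrite !inE /cyc_succ => yr ysr.
(* As [1 < s], the exponents [s] and [2 * s] are not adjacent, so [k] is a neighbour of one of
   them. *)
have {yr ysr} adjr : [|| k == 2 * s + 1, k + 1 == 2 * s, k == s + 1 | k + 1 == s].
  have k0 : 0 < k by case/or4P: cases => /and4P[]; lia.
  case/or3P: yr ysr => /eqP -> /or3P[] /eqP; case: ifP => /eqP ? ?; lia.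
move=> xl xsl.
(* Likewise [l0] and [l1] differ by [s], so one of them is a cyclic neighbour of 0. *)
have {xl xsl} adjl : [|| l0 == 1, l0 + 1 == 4 * s + 1, l1 == 1 | l1 + 1 == 4 * s + 1].
  case/or3P: xl xsl => /eqP -> /or3P[] /eqP; case: ifP => /eqP ? ?;
    by case/or4P: cases => /and4P[? ? /eqP ? /eqP ?]; lia.
case/or4P: adjl => /eqP ?; case/or4P: adjr => /eqP ?;
  by case/or4P: cases => /and4P[? ? /eqP ? /eqP ?]; lia.
Qed.

(** * The exceptional values of [k], by explicit carries *)

Ltac decide_eqs :=
  repeat match goal with
  | |- context [?x == ?y] =>
      first [rewrite (_ : (x == y) = false); last lia
            |rewrite (_ : (x == y) = true); last lia]; rewrite /=
  end.

Ltac eval_carry :=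
  repeat match goal with
  | |- context [carry ?n ?x ?l] =>
      first [rewrite (@carry_notin n x l); last by rewrite ?inE; lia
            |rewrite (@carry_in n x l); last by rewrite ?inE; lia];
      rewrite /cyc_succ /=; decide_eqs
  end.

Ltac split_carry x l :=
  let H := fresh in
  case: (boolP (x \in l)) => H;
  [move: H; rewrite !inE; repeat (case/orP); move/eqP => -> |
   rewrite (carry_notin _ H); clear H].

Ltac refute_perm x y :=
  let H := fresh in
  move=> H; first [by have := perm_size H
  |by have := perm_mem H x; rewrite !inE; lia
  |by have := perm_mem H y; rewrite !inE; lia].

(** Each choice of [a] in or outside [l] and [b] in or outside [r] gives explicit lists; they differ
    in length or in containing [x] or [y]. *)
Ltac refute_relation a l b r x y :=
  case/(_ _)/Wrap; first (by rewrite /reduced; split_lia);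
  case/(_ _)/Wrap; first (by rewrite /reduced; split_lia);
  split_carry a l; split_carry b r; eval_carry; refute_perm x y.

(* [k = s], after cancelling [2^(2s)]; [s, s] has been merged to [s + 1]. *)
Lemma no_relation_s s a b (n := 4 * s + 1) : 1 < s -> a < n -> b < n ->
  psum [:: a; 3 * s; 0] = psum [:: b; s + 1] %[mod 2 ^ n - 1] -> False.
Proof.
rewrite /n => s1 an bn /carry_unique-/(_ an _ bn).
refute_relation a [:: 3 * s; 0] b [:: s + 1] (s + 1) 0.
Qed.

(* [k = -s], after cancelling [2^s]; [0, 0] has been merged to [1]. *)
Lemma no_relation_Ns s a b (n := 4 * s + 1) : 1 < s -> a < n -> b < n ->
  psum [:: a; 1] = psum [:: b; 3 * s + 1; 2 * s] %[mod 2 ^ n - 1] -> False.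
Proof.
rewrite /n => s1 an bn /carry_unique-/(_ an _ bn).
refute_relation a [:: 1] b [:: 3 * s + 1; 2 * s] 1 0.
Qed.

(** The case [k = 2 * s], with the two copies of [2 * s] merged. Since [4 * s] and 0 are cyclically
    adjacent, [a = 4 * s] carries twice. *)
Lemma no_relation_2s s a b (n := 4 * s + 1) : 1 < s -> a < n -> b < n ->
  psum [:: a; 4 * s; 3 * s; 0] = psum [:: b; 2 * s + 1; s] %[mod 2 ^ n - 1] ->
  False.
Proof.
rewrite /n => s1 an bn /carry_unique-/(_ an _ bn).
refute_relation a [:: 4 * s; 3 * s; 0] b [:: 2 * s + 1; s] (2 * s + 1) s.
Qed.

(** The case [k = -2s], with the two zeros merged into 1. Here [b = 2 * s] carries twice. *)
Lemma no_relation_N2s s a b (n := 4 * s + 1) : 1 < s -> a < n -> b < n ->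
  psum [:: a; 3 * s + 1; 1] = psum [:: b; 2 * s + 1; 2 * s; s] %[mod 2 ^ n - 1] ->
  False.
Proof.
rewrite /n => s1 an bn /carry_unique-/(_ an _ bn).
refute_relation a [:: 3 * s + 1; 1] b [:: 2 * s + 1; 2 * s; s] 1 (3 * s + 1).
Qed.

(** * The relation for arbitrary exponents *)

Lemma psum_modn n l :
  psum [seq x %% n | x <- l] = psum l %[mod 2 ^ n - 1].
Proof.
elim: l => [|x l IHl] //=; rewrite !psum_cons.
by rewrite -modnDm pow2_mod_period IHl modnDm.
Qed.

Lemma modn_wrap n x : x < 2 * n -> x %% n = if x < n then x else x - n.
Proof.
move=> lt_x2n; case: (ltnP x n) => [|le_nx]; first exact: modn_small.
by have := modnDr (x - n) n; rewrite subnK // => ->; rewrite modn_small //; lia.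
Qed.

Lemma psum_merge x l : psum (x :: x :: l) = psum (x + 1 :: l).
Proof. by rewrite !psum_cons addn1 expnS addnA mul2n addnn. Qed.

Lemma psum_cancel n x l r :
  psum (x :: l) = psum (x :: r) %[mod 2 ^ n - 1] ->
  psum l = psum r %[mod 2 ^ n - 1].
Proof. by rewrite !psum_cons => /eqP; rewrite eqn_modDl => /eqP. Qed.

Lemma psum_perm l r : perm_eq l r -> psum l = psum r.
Proof. exact: perm_big. Qed.

Ltac reorder l r :=
  rewrite (@psum_perm l r); last by apply/permP => ? /=; lia.

(** For [k = 0] modulo [n] the relation holds whenever [a = b]. Otherwise two known exponents
    coincide modulo [n] only for [k] equal to [s], [2 * s], [2 * s + 1 = -2s] or [3 * s + 1 = -s];
    the generic case covers the rest. *)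
Lemma no_relation s k a b (n := 4 * s + 1) : 1 < s -> ~~ (n %| k) ->
  psum [:: a; k + 2 * s; k + s; 0] = psum [:: b; k; 2 * s; s] %[mod 2 ^ n - 1] ->
  False.
Proof.
move=> s1 ndk; have n0 : 0 < n by rewrite /n; lia.
rewrite -psum_modn -[in RHS]psum_modn /= -(modnDml k) -(modnDml k s).
move: ndk (ltn_pmod k n0) (ltn_pmod a n0) (ltn_pmod b n0); rewrite /dvdn mod0n.
move: (k %% n) (a %% n) (b %% n) => {}k {}a {}b k0 kn an bn.
rewrite (@modn_small s) ?(@modn_small (2 * s)); [|rewrite /n; lia..].
rewrite (@modn_wrap n (k + _)) ?(@modn_wrap n (k + s)); [|rewrite /n in kn *; lia..].
case: (eqVneq k s) => [->|ks].
  rewrite !ifT; [|rewrite /n; lia..].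
  have -> : s + s = 2 * s by lia.
  have -> : s + 2 * s = 3 * s by lia.
  reorder [:: a; 3 * s; 2 * s; 0] [:: 2 * s; a; 3 * s; 0].
  reorder [:: b; s; 2 * s; s] [:: s; s; 2 * s; b].
  rewrite psum_merge; reorder [:: s + 1; 2 * s; b] [:: 2 * s; b; s + 1].
  by move/psum_cancel; apply: no_relation_s.
case: (eqVneq k (2 * s)) => [->|k2s].
  rewrite !ifT; [|rewrite /n; lia..].
  have -> : 2 * s + s = 3 * s by lia.
  have -> : 2 * s + 2 * s = 4 * s by lia.
  reorder [:: b; 2 * s; 2 * s; s] [:: 2 * s; 2 * s; b; s].
  rewrite psum_merge; reorder [:: 2 * s + 1; b; s] [:: b; 2 * s + 1; s].
  exact: no_relation_2s.
case: (eqVneq k (2 * s + 1)) => [->|k2s1].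
  rewrite ifF ?ifT; [|rewrite /n; lia..].
  have -> : 2 * s + 1 + s = 3 * s + 1 by rewrite /n; lia.
  have -> : 2 * s + 1 + 2 * s - n = 0 by rewrite /n; lia.
  reorder [:: a; 0; 3 * s + 1; 0] [:: 0; 0; a; 3 * s + 1].
  rewrite psum_merge add0n; reorder [:: 1; a; 3 * s + 1] [:: a; 3 * s + 1; 1].
  exact: no_relation_N2s.
case: (eqVneq k (3 * s + 1)) => [->|k3s1].
  rewrite !ifF; [|rewrite /n; lia..].
  have -> : 3 * s + 1 + s - n = 0 by rewrite /n; lia.
  have -> : 3 * s + 1 + 2 * s - n = s by rewrite /n; lia.
  reorder [:: a; s; 0; 0] [:: 0; 0; s; a].
  rewrite psum_merge add0n; reorder [:: 1; s; a] [:: s; a; 1].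
  reorder [:: b; 3 * s + 1; 2 * s; s] [:: s; b; 3 * s + 1; 2 * s].
  by move/psum_cancel; apply: no_relation_Ns.
apply: no_relation_generic => //; clear an bn n0; rewrite /n in kn *.
case: (ltnP (k + 2 * s)); case: (ltnP (k + s)); lia.
Qed.

(** * From the exponents to the relation, written without subtraction *)

Lemma esum_geometric l i : esum l i * 2 ^ i + 1 = 2 ^ (l * i) + esum l i.
Proof.
rewrite /esum; elim: l => [|l IHl]; first by rewrite !big_ord0.
rewrite !big_ord_recr /= mulnDl mulSn expnD.
move: (\sum_(j < l) _) IHl => e IHl; lia.
Qed.

Lemma modinv_modinv m d : coprime d m -> modinv m (modinv m d) = d %[mod m].
Proof.
move=> co_dm; have inv_d := modinvP co_dm.
have co_inv : coprime (modinv m d) m.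
  move: (coprime1n m); rewrite -coprime_modl -inv_d coprime_modl coprimeMl.
  by case/andP.
rewrite -[in LHS](mul1n (modinv m (modinv m d))) -modnMml -inv_d modnMml.
by rewrite -mulnA -modnMmr (modinvP co_inv) modnMmr muln1.
Qed.

Lemma even_nihoE s : (even_niho (2 * s)).+1 = 2 ^ (2 * s) + 2 ^ s.
Proof.
rewrite /even_niho mul2n doubleK; have := expn_gt0 2 s; lia.
Qed.

(** Multiply by [2^i - 1]: the geometric sum becomes [2^((s+1)i) - 1], and expanding its product
    with [2^(2s) + 2^s - 1] and moving the negative terms across gives the relation with
    [b = a + i]. *)
Lemma relation_of_inverse s n i a :
  2 ^ a = esum s.+1 i * even_niho (2 * s) %[mod 2 ^ n - 1] ->
  psum [:: a; s.+1 * i + 2 * s; s.+1 * i + s; 0] =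
  psum [:: a + i; s.+1 * i; 2 * s; s] %[mod 2 ^ n - 1].
Proof.
rewrite !psum_cons psum_nil !(expnD 2 (s.+1 * i)) (expnD 2 a) => H.
have Ne := even_nihoE s; have ge := esum_geometric s.+1 i.
rewrite -modnDml H modnDml -[in RHS]modnDml -[in RHS]modnMml H modnMml modnDml.
congr (_ %% _); move: Ne ge.
move: (esum _ _) (even_niho _) (2 ^ (2 * s)) (2 ^ s) (2 ^ i) (2 ^ (_ * i)).
clear H => e N A B I K Ne ge; rewrite expn0.
have : (K + e) * N = (e * I + 1) * N by rewrite ge.
have : K * (A + B) = K * N.+1 by rewrite Ne.
lia.
Qed.

(* [2^(a (n-1))] is the inverse of [2^a] modulo [2^n - 1]. *)
Lemma relation_of_shift s n i a : 0 < n ->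
  esum s.+1 i = 2 ^ a * even_niho (2 * s) %[mod 2 ^ n - 1] ->
  psum [:: a * n.-1; i + 2 * s; i + s; 0] =
  psum [:: a * n.-1 + s.+1 * i; i; 2 * s; s] %[mod 2 ^ n - 1].
Proof.
rewrite !psum_cons psum_nil !(expnD 2 i) (expnD 2 (a * n.-1)) => n0 H.
have Ne := even_nihoE s; have ge := esum_geometric s.+1 i.
set c := a * n.-1.
have {H} H : 2 ^ c * esum s.+1 i = even_niho (2 * s) %[mod 2 ^ n - 1].
  rewrite -modnMmr H modnMmr mulnA -expnD.
  have -> : c + a = a * n by rewrite /c -mulnSr prednK.
  by rewrite -modnMml -pow2_mod_period modnMl modnMml mul1n.
(* Adding the Niho exponent to both sides, and writing it as [2^c] times the geometric sum on the
   right, makes [esum_geometric] applicable without subtraction. *)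
apply/eqP; rewrite -(eqn_modDr (even_niho (2 * s))); apply/eqP.
rewrite -[in RHS]modnDmr -H modnDmr.
have -> : 2 ^ c * 2 ^ (s.+1 * i) + (2 ^ i + (2 ^ (2 * s) + (2 ^ s + 0))) +
    2 ^ c * esum s.+1 i =
  2 ^ c * esum s.+1 i * 2 ^ i + (2 ^ c + (2 ^ i + (2 ^ (2 * s) + 2 ^ s))).
  rewrite -mulnA; have := congr1 (muln (2 ^ c)) ge; rewrite !mulnDr muln1; lia.
rewrite -[in RHS]modnDml -[in RHS]modnMml H modnMml modnDml -Ne.
congr (_ %% _); rewrite addn0 expn0.
have : 2 ^ i * (2 ^ (2 * s) + 2 ^ s) = 2 ^ i * (even_niho (2 * s)).+1 by rewrite Ne.
rewrite mulnDr mulnS (mulnC (even_niho _)); lia.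
Qed.

Theorem theorem7 (t n i : nat) (ht : 2 < t) (ht_even : ~~ odd t)
    (hn : n = 2 * t + 1) (hi : gcdn i n = 1) :
  ~ cyclotomic_equiv n (modinv (2 ^ n - 1) (even_niho t)) (esum ((t + 2)./2) i).
Proof.
have co_N := coprime_even_niho ht_even; rewrite -hn in co_N.
have [s et] : exists s, t = 2 * s by exists t./2; lia.
have es : (t + 2)./2 = s.+1 by lia.
have s1 : 1 < s by lia.
have en : n = 4 * s + 1 by lia.
have n0 : 0 < n by lia.
have co_ni : coprime n i by rewrite coprime_sym /coprime hi.
have ndi : ~~ (4 * s + 1 %| i).
  rewrite -en; apply/negP => /gcdn_idPr; rewrite hi; lia.
(* Being coprime to [i], [n] would divide [s.+1], which is positive and smaller than [n]. *)
have ndk : ~~ (4 * s + 1 %| s.+1 * i).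
  rewrite -en Gauss_dvdl //; apply/negP => /dvdn_leq; lia.
rewrite es et in co_N *; case=> [[a H]|[co_inv [a H]]].
(* Multiplying the equivalence by the Niho exponent cancels its inverse. *)
- apply: (@no_relation s (s.+1 * i) a (a + i) s1 ndk).
  rewrite -en; apply: relation_of_inverse.
  rewrite -modnMml -H modnMml -mulnA (mulnC (modinv _ _)).
  by rewrite -modnMmr modinvP // modnMmr muln1.
(* Here the inverse of the inverse is the Niho exponent itself. *)
- apply: (@no_relation s i (a * n.-1) (a * n.-1 + s.+1 * i) s1 ndi).
  rewrite -en; apply: relation_of_shift n0 _.
  by rewrite -H -modnMmr modinv_modinv // modnMmr.
Qed.
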